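(* Let $\aleph$ be an infinite cardinal and let $\mathcal{F}=\{F_\alpha:\alpha\in\mathcal{A}\}$ be a family of graphs (not necessarily pairwise non-isomorphic), each of order $\aleph$ and each having at least one edge. Suppose that $|\mathcal{A}|=\aleph$ and that the domination number of each $F_\alpha$ equals $\aleph$. Then there exists a factorization $\{\Gamma_\alpha:\alpha\in\mathcal{A}\}$ of the complete graph $K_\aleph$ such that $\Gamma_\alpha$ is isomorphic to $F_\alpha$ for every $\alpha\in\mathcal{A}$.
   Context: All graphs are simple; the order of a graph is the cardinality of its vertex set. $K_\aleph$ is the complete graph on a vertex set of cardinality $\aleph$. A factor of a graph $\Lambda$ is a spanning subgraph; a factorization of $\Lambda$ is a family of factors of $\Lambda$ whose edge sets partition $E(\Lambda)$. A set $D$ of vertices is dominating if every vertex not in $D$ is adjacent to some vertex of $D$; the domination number is the minimum cardinality of a dominating set. Work in ZFC. *)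

(* Defs.v *)
From mathcomp Require Export all_boot.
From mathcomp Require Export boolp classical_sets functions cardinality.

Set Implicit Arguments.
Unset Strict Implicit.
Unset Printing Implicit Defensive.

Local Open Scope classical_set_scope.
Local Open Scope card_scope.

(* The vertex set is the whole (possibly infinite) type V. *)
Record graph (V : Type) := Graph {
  adj : V -> V -> Prop;
  adj_sym : forall x y, adj x y -> adj y x;
  adj_irrefl : forall x, ~ adj x x
}.

Lemma complete_sym (V : Type) (x y : V) : x <> y -> y <> x.
Proof. by move=> xy yx; apply: xy. Qed.

Lemma complete_irrefl (V : Type) (x : V) : ~ (x <> x).
Proof. by move=> xx; apply: xx. Qed.

Definition complete (V : Type) : graph V :=
  Graph (@complete_sym V) (@complete_irrefl V).

(* Edges are unordered pairs. *)
Definition edges (V : Type) (G : graph V) : set (set V) :=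
  [set e | exists x y : V, adj G x y /\ e = [set x; y]].

(* A subgraph on the same vertex type V is spanning by construction. *)
Definition factor (V : Type) (H G : graph V) : Prop :=
  edges H `<=` edges G.

Definition factorization (V A : Type) (G : graph V) (Gamma : A -> graph V)
    : Prop :=
  (forall a, factor (Gamma a) G) /\
  partition [set: A] (fun a => edges (Gamma a)) (edges G).

Definition isomorphic (V W : Type) (G : graph V) (H : graph W) : Prop :=
  exists2 f : V -> W, bijective f &
    forall x y : V, adj G x y <-> adj H (f x) (f y).

Definition dominating (V : Type) (G : graph V) (D : set V) : Prop :=
  forall x : V, ~ D x -> exists2 y : V, D y & adj G x y.

(* There is no type of cardinals: "the domination number of G is |C|" says
   that |C| is attained by, and is a lower bound for, the cardinalities of the
   dominating sets. *)
Definition domination_number_eq (V T : Type) (G : graph V) (C : set T)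
    : Prop :=
  (exists2 D : set V, dominating G D & D #= C) /\
  (forall D : set V, dominating G D -> C #<= D).

(* Main.v *)
(** Well-order the vertex set so that every proper initial segment has fewer
    than [|K|] elements, and build all embeddings [F a -> K] simultaneously as
    one set of triples [(a, v, x)], read "the vertex [v] of [F a] is placed at
    [x]".  Before each stage fewer than [|K|] triples have been chosen.  An
    unplaced vertex [v] goes to an [x] that occurs in no triple, which cannot
    create a conflict.  A point [x] missing from copy [a] receives a vertex
    that is neither placed nor adjacent to a placed vertex: it exists because
    the placed vertices are too few to dominate [F a], and it creates no edge.
    A pair [x, y] not covered yet receives an edge of some [F a] none of whose
    vertices have been placed.  Since [|K| * |K| = |K|], all these requirements
    can be listed along [K]. *)

Require Import Defs.
From mathcomp Require Import wochoice.

Set Implicit Arguments.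
Unset Strict Implicit.
Unset Printing Implicit Defensive.

Local Open Scope classical_set_scope.
Local Open Scope card_scope.

(** * Cardinal arithmetic *)

(** [R] need not be functional: any choice function for it on [A] is injective by the second
    hypothesis. *)
Lemma card_le_rel (T U : Type) (A : set T) (B : set U) (R : T -> U -> Prop) :
  (forall x, A x -> exists2 y, B y & R x y) ->
  (forall x x' y, A x -> A x' -> R x y -> R x' y -> x = x') ->
  A #<= B.
Proof.
move=> AB Rinj; have [->|/set0P[x0 Ax0]] := eqVneq A set0.
  exact: card_ge0.
have [y0 _ _] := AB _ Ax0.
have /choice[f fP] : forall x, exists y, A x -> B y /\ R x y.
  move=> x; have [Ax|nAx] := pselect (A x); last by exists y0.
  by have [y By Rxy] := AB _ Ax; exists y.
apply: (@card_le_trans _ _ _ (f @` A)).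
  have fA : {in A &, injective f}.
    move=> x x' /set_mem Ax /set_mem Ax' fxx'.
    apply: (Rinj x x' (f x)) => //; first by case: (fP x).
    by rewrite fxx'; case: (fP x').
  by have /card_esym := inj_card_eq fA; rewrite card_eq_le => /andP[].
by apply: subset_card_le => _ [x Ax <-]; case: (fP x).
Qed.

Lemma card_le_fun (T U : Type) (A : set T) (B : set U) (u0 : U) :
  A #<= B -> exists2 f : T -> U, (forall x, A x -> B (f x)) &
    forall x x', A x -> A x' -> f x = f x' -> x = x'.
Proof.
elim/Ppointed: U => U in B u0 *; first by have := no u0.
move=> /pcard_leP[f]; exists f; first by move=> x Ax; exact: funS.
by move=> x x' Ax Ax'; apply: inj; exact: mem_set.
Qed.

Lemma card_eq_bijective (T U : Type) (u0 : U) :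
  [set: T] #= [set: U] -> exists f : T -> U, bijective f.
Proof.
elim/Ppointed: U => U in u0 *; first by have := no u0.
by move=> /card_set_bijP[f fbij]; exists f; rewrite -setTT_bijective.
Qed.

Lemma card_leX (T T' U U' : Type) (A : set T) (B : set U) (A' : set T')
    (B' : set U') :
  A #<= B -> A' #<= B' -> A `*` A' #<= B `*` B'.
Proof.
have [->|/set0P[x Ax]] := eqVneq A set0; first by rewrite set0X card_ge0.
have [->|/set0P[x' Ax']] := eqVneq A' set0; first by rewrite setX0 card_ge0.
have [->|/set0P[u _]] := eqVneq B set0.
  by move/card_le0P=> A0; move: Ax; rewrite A0.
have [->|/set0P[u' _]] := eqVneq B' set0.
  by move=> _ /card_le0P A0; move: Ax'; rewrite A0.
move=> /(card_le_fun u)[f fB finj] /(card_le_fun u')[f' fB' finj'].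
apply: (card_le_rel (R := fun p q => q = (f p.1, f' p.2))).
  move=> [y y'] [/= Ay Ay'].
  by exists (f y, f' y') => //; split; [exact: fB|exact: fB'].
move=> [y y'] [z z'] q [/= Ay Ay'] [/= Az Az'] -> [].
by move=> /(finj _ _ Ay Az)-> /(finj' _ _ Ay' Az')->.
Qed.

(** Serves to pass finitary properties to the union of a chain: repeated use gathers finitely many
    elements in one member. *)
Lemma chain_cofinal (T : Type) (F : set (set T)) (X : set T) (u : T) :
  total_on F subset -> F X -> (\bigcup_(Y in F) Y) u ->
  exists Y, [/\ F Y, X `<=` Y & Y u].
Proof.
move=> Ftot FX [Y FY Yu]; have [XY|YX] := Ftot _ _ FX FY; first by exists Y.
by exists X; split=> //; exact: YX.
Qed.

(** Zorn's lemma gives a maximal graph of a partial injection; if points were missing from both its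
    domain and its range, a pair of them could be added. *)
Lemma card_le_total (T U : Type) (A : set T) (B : set U) :
  A #<= B \/ B #<= A.
Proof.
pose P (G : set (T * U)) := [/\ forall x y, G (x, y) -> A x /\ B y,
  forall x y y', G (x, y) -> G (x, y') -> y = y' &
  forall x x' y, G (x, y) -> G (x', y) -> x = x'].
have [F FP Ftot|G [[GAB Gfun Ginj] Gmax]] := @Zorn_bigcup _ P.
  split=> [x y [X /FP[XAB _ _] /XAB]//|x y y' [X FX Xxy]|x x' y [X FX Xxy]].
    move=> /(chain_cofinal Ftot FX)[Y [/FP[_ Yf _] XY Yxy]].
    exact: (Yf x y y' (XY _ Xxy)).
  move=> /(chain_cofinal Ftot FX)[Y [/FP[_ _ Yi] XY Yxy]].
  exact: (Yi x x' y (XY _ Xxy)).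
have [Adom|] := pselect (forall x, A x -> exists y, G (x, y)).
  left; apply: (card_le_rel (R := fun x y => G (x, y))).
    by move=> x /Adom[y Gxy]; exists y => //; have [] := GAB _ _ Gxy.
  by move=> x x' y _ _; exact: Ginj.
move=> /existsNP[x /not_implyP[Ax /forallNP nGx]].
have [Bdom|] := pselect (forall y, B y -> exists x, G (x, y)).
  right; apply: (card_le_rel (R := fun y x => G (x, y))).
    by move=> y /Bdom[z Gzy]; exists z => //; have [] := GAB _ _ Gzy.
  by move=> y y' z _ _; exact: Gfun.
move=> /existsNP[y /not_implyP[By /forallNP nGy]].
exfalso; apply: (Gmax (G `|` [set (x, y)])).
  split; first by move=> p; left.
  by move=> /(_ (x, y)) Gxy; apply: (nGx y); apply: Gxy; right.
split=> [x1 y1 [/GAB//|[-> ->]]//|x1 y1 y2|x1 x2 y1].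
- move=> [G1|[e1 ->]] [G2|[e2 ->]] //; first exact: Gfun G1 G2.
    by case: (nGx y1); rewrite -e2.
  by case: (nGx y2); rewrite -e1.
- move=> [G1|[-> e1]] [G2|[-> e2]] //; first exact: Ginj G1 G2.
    by case: (nGy x1); rewrite -e2.
  by case: (nGy x2); rewrite -e1.
Qed.

(** * The square of an infinite cardinal *)

Section CardSquare.
Variables (T : Type) (A : set T).
Hypothesis Ainf : infinite_set A.

Let dom (G : set (T * T * T)) : set T := [set x | exists z, G (x, x, z)].

(** Graph of an injection from the square of [D] into [D], where [D = dom G] lies in [A]. Reading
    [D] off the diagonal lets [G] alone carry the data, so Zorn's lemma applies to inclusion. *)
Let pairing (G : set (T * T * T)) : Prop :=
  [/\ forall x y z, G (x, y, z) -> [/\ dom G x /\ A x, dom G y & dom G z],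
      forall x y, dom G x -> dom G y -> exists z, G (x, y, z),
      forall x y z z', G (x, y, z) -> G (x, y, z') -> z = z' &
      forall x y x' y' z, G (x, y, z) -> G (x', y', z) -> (x, y) = (x', y')].

Let pairing_bigcup (F : set (set (T * T * T))) :
  F `<=` pairing -> total_on F subset -> pairing (\bigcup_(X in F) X).
Proof.
move=> FP Ftot.
have domF X x : F X -> dom X x -> dom (\bigcup_(X in F) X) x.
  by move=> FX [z Xz]; exists z, X.
split=> [x y z [X FX Xxyz]|x y [z [X FX Xz]] [z']|x y z z' [X FX Xxy]|].
- have [/(_ _ _ _ Xxyz)[[Dx Ax] Dy Dz] _ _ _] := FP _ FX.
  by split; [split=> //; exact: domF Dx|exact: domF Dy|exact: domF Dz].
- move=> /(chain_cofinal Ftot FX)[Y [FY XY Yz']].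
  have [_ Ytot _ _] := FP _ FY.
  have [w Yw] : exists w, Y (x, y, w).
    by apply: Ytot; [exists z; exact: XY|exists z'].
  by exists w, Y.
- move=> /(chain_cofinal Ftot FX)[Y [/FP[_ _ Yf _] XY Yxy]].
  exact: (Yf x y z z' (XY _ Xxy)).
- move=> x y x' y' z [X FX Xxy].
  move=> /(chain_cofinal Ftot FX)[Y [/FP[_ _ _ Yi] XY Yxy]].
  exact: (Yi x y x' y' z (XY _ Xxy)).
Qed.

(** A copy of [nat] inside [A] carries an injection of pairs of naturals into naturals; it is the
    starting point for Zorn's lemma. *)
Let pairing_nat : exists G, pairing G /\ infinite_set (dom G).
Proof.
have /infinite_setN0[t0 _] := Ainf.
have /infiniteP/(card_le_fun t0)[h hA hinj0] := Ainf.
have hinj : injective h by move=> m n; exact: hinj0.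
have : [set: nat * nat] #<= [set: nat].
  by have := card_nat2; rewrite card_eq_le => /andP[].
move=> /(card_le_fun 0%N)[c _ cinj0].
have cinj : injective c by move=> m n; exact: cinj0.
exists [set p | exists m n, p = (h m, h n, h (c (m, n)))].
have domE m : dom [set p | exists m n, p = (h m, h n, h (c (m, n)))] (h m).
  by exists (h (c (m, m))), m, m.
split; last first.
  apply/infiniteP; apply: (card_le_rel (R := fun n x => x = h n)) => [n _|].
    by exists (h n).
  by move=> m n x _ _ -> /hinj->.
split=> [x y z [m [n [-> -> ->]]]||x y z z'|x y x' y' z].
- by split; [split; [exact: domE|exact: hA]|exact: domE|exact: domE].
- move=> x y [z [m [m' [-> _ _]]]] [z' [n [n' [-> _ _]]]].
  by exists (h (c (m, n))), m, n.
- by move=> [m [n [-> -> ->]]] [m' [n' [/hinj-> /hinj-> ->]]].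
- move=> [m [n [-> -> ->]]] [m' [n' [-> -> /hinj/cinj]]].
  by move=> [-> ->].
Qed.

(* [D `*` D] injects into [D]; doubling [D] by a disjoint copy [e D], the three
   remaining blocks of the square are sent into [e D], tagged by three distinct
   elements of [D]. *)
Let pairing_double (G : set (T * T * T)) : pairing G -> infinite_set (dom G) ->
  dom G #<= A `\` dom G -> exists2 G', G `<` G' & pairing G'.
Proof.
move=> [Gdom Gtot Gfun Ginj] Dinf; set D := dom G.
have /infinite_setN0[t0 Dt0] := Dinf.
move=> /(card_le_fun t0)[e eD einj].
have /infiniteP/(card_le_fun t0)[h hD hinj0] := Dinf.
have hinj : injective h by move=> m n; exact: hinj0.
have /choice[f fP] : forall p : T * T, exists z, D p.1 -> D p.2 -> G (p, z).
  move=> [x y]; have [[Dx Dy]|nD] := pselect (D x /\ D y).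
    by have [z Gz] := Gtot _ _ Dx Dy; exists z.
  by exists t0 => Dx Dy; case: nD.
have fD x y : D x -> D y -> D (f (x, y)).
  by move=> Dx Dy; have [_ _] := Gdom _ _ _ (fP (x, y) Dx Dy).
have finj x y x' y' : D x -> D y -> D x' -> D y' ->
    f (x, y) = f (x', y') -> x = x' /\ y = y'.
  move=> Dx Dy Dx' Dy' E; have := fP (x', y') Dx' Dy'; rewrite -E => G'.
  by have [-> ->] := Ginj _ _ _ _ _ (fP (x, y) Dx Dy) G'.
pose c (b : bool) x := if b then e x else x.
have cinj b x b' x' : D x -> D x' -> c b x = c b' x' -> b = b' /\ x = x'.
  move=> Dx Dx'; case: b b' => [] [] //= E; first by rewrite (einj x x').
    by have [_ []] := eD _ Dx; rewrite E.
  by have [_ []] := eD _ Dx'; rewrite -E.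
(* The block with [b] and [b'] both false keeps the values of [f], so [G'] extends [G]; the other
   three blocks get the tags [h 1], [h 2] and [h 3]. *)
pose val b b' x y : T :=
  if b || b' then e (f (f (x, y), h (b + b'.*2)%N)) else f (x, y).
have valinj b1 b1' b2 b2' x1 y1 x2 y2 : D x1 -> D y1 -> D x2 -> D y2 ->
    val b1 b1' x1 y1 = val b2 b2' x2 y2 ->
    [/\ b1 = b2, b1' = b2', x1 = x2 & y1 = y2].
  move=> Dx1 Dy1 Dx2 Dy2; have hh n : D (h n) by exact: hD.
  have Df1 := fD _ _ Dx1 Dy1; have Df2 := fD _ _ Dx2 Dy2.
  rewrite /val; case: ifPn => b1P; case: ifPn => b2P E.
  - have [/finj[]// -> ->] := finj _ _ _ _ Df1 (hh _) Df2 (hh _)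
      (einj _ _ (fD _ _ Df1 (hh _)) (fD _ _ Df2 (hh _)) E).
    by move=> /hinj; case: b1 b1' b2 b2' {b1P b2P E} => [] [] [] [].
  - have [_ []] := eD _ (fD _ _ Df1 (hh (b1 + b1'.*2)%N)).
    by rewrite E; exact: fD.
  - have [_ []] := eD _ (fD _ _ Df2 (hh (b2 + b2'.*2)%N)).
    by rewrite -E; exact: fD.
  - have [] := finj _ _ _ _ Dx1 Dy1 Dx2 Dy2 E.
    by case: b1 b1' b2 b2' {E} b1P b2P => [] [] [] [].
pose G' : set (T * T * T) := [set p | exists b b' x y,
  [/\ D x, D y & p = (c b x, c b' y, val b b' x y)]].
have domG' b x : D x -> dom G' (c b x).
  by move=> Dx; exists (val b b x x), b, b, x, x.
have domG'E x : dom G' x -> exists b y, D y /\ x = c b y.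
  by move=> [z [b [b' [y [y' [Dy Dy' [-> _ _]]]]]]]; exists b, y.
exists G'.
  split.
    move=> [[x y] z] Gxyz; have [[Dx _] Dy _] := Gdom _ _ _ Gxyz.
    exists false, false, x, y; split => //=; congr (_, _, _).
    exact: (Gfun _ _ _ _ Gxyz (fP (x, y) Dx Dy)).
  move=> G'G; have [z /G'G] := domG' true _ Dt0.
  by move=> /Gdom[/= [De _] _ _]; have [] := eD _ Dt0.
split=> [_ _ _ [b [b' [x [y [Dx Dy [-> -> ->]]]]]]||x y z z'|x y x' y' z].
- split; [split; first exact: domG'|exact: domG'|].
    case: b => /=; first by have [] := eD _ Dx.
    by have [w /Gdom[[]]] := Dx.
  have Df := fD _ _ Dx Dy; have Dff := fD _ _ Df (hD (b + b'.*2)%N I).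
  by rewrite /val; case: ifPn => _; [exact: (domG' true)|exact: (domG' false)].
- move=> _ _ /domG'E[b [x [Dx ->]]] /domG'E[b' [y [Dy ->]]].
  by exists (val b b' x y), b, b', x, y.
- move=> [b1 [b1' [x1 [y1 [Dx1 Dy1 [-> -> ->]]]]]].
  move=> [b2 [b2' [x2 [y2 [Dx2 Dy2 [+ + ->]]]]]].
  by move=> /(cinj _ _ _ _ Dx1 Dx2)[-> ->] /(cinj _ _ _ _ Dy1 Dy2)[-> ->].
- move=> [b1 [b1' [x1 [y1 [Dx1 Dy1 [-> -> ->]]]]]].
  move=> [b2 [b2' [x2 [y2 [Dx2 Dy2 [-> ->]]]]]].
  by move=> /(valinj _ _ _ _ _ _ _ _ Dx1 Dy1 Dx2 Dy2)[-> -> -> ->].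
Qed.

(** For a maximal pairing with infinite domain, [pairing_double] forbids a complement in [A] as
    large as the domain. So the complement injects into the domain, and [A] into two copies of the
    domain, hence into its square and into the domain itself. *)
Lemma card_square_le : A `*` A #<= A.
Proof.
have [G0 [G0P G0inf]] := pairing_nat.
(* Maximality is taken among pairings containing [G0], which keeps the domain infinite; the empty
   chain is then bounded by [G0] itself. *)
have [F FP Ftot|G [GP Gmax]] := @Zorn_bigcup _ (fun G => pairing (G0 `|` G)).
  have [->|/set0P[X0 FX0]] := eqVneq F set0.
    by rewrite bigcup_set0 setU0.
  rewrite setUC -bigcupUl//; last by exists X0.
  rewrite -(bigcup_image F (fun X => X `|` G0) id).
  apply: pairing_bigcup => [_ [X FX <-]|_ _ [X FX <-] [Y FY <-]].
    by rewrite setUC; exact: FP.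
  by have [XY|YX] := Ftot _ _ FX FY; [left|right]; exact: setSU.
set H := G0 `|` G in GP.
have Hinf : infinite_set (dom H).
  by apply: sub_infinite_set G0inf => x [z G0z]; exists z; left.
have [Hdom Htot Hfun Hinj] := GP.
have HH : dom H `*` dom H #<= dom H.
  apply: (card_le_rel (R := fun p z => H (p, z))) => [[x y] [/= Dx Dy]|].
    have [z Hz] := Htot _ _ Dx Dy; exists z => //.
    by have [_ _] := Hdom _ _ _ Hz.
  by move=> [x y] [x' y'] z _ _; exact: Hinj.
have [AD|DA] := card_le_total (A `\` dom H) (dom H); last first.
  have [H' [HH' nH'H] H'P] := pairing_double GP Hinf DA.
  exfalso; apply: (Gmax H').
    split; first by move=> p Gp; apply: HH'; right.
    by move=> H'G; apply: nH'H => p /H'G; right.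
  by have /setUidPr -> : G0 `<=` H' by move=> p G0p; apply: HH'; left.
have [t0 Dt0] := infinite_setN0 Hinf.
have /infiniteP/(card_le_fun t0)[h hD hinj0] := Hinf.
have hinj : injective h by move=> m n; exact: hinj0.
have AD2 : A #<= dom H `*` dom H.
  have [e eD einj] := card_le_fun t0 AD.
  apply: (card_le_rel (R := fun x p => (dom H x /\ p = (x, h 0%N)) \/
    (~ dom H x /\ p = (e x, h 1%N)))) => [x Ax|].
    have [Dx|nDx] := pselect (dom H x).
      by exists (x, h 0%N); [split=> //; exact: hD|left].
    by exists (e x, h 1%N); [split; [exact: eD|exact: hD]|right].
  move=> x x' p Ax Ax' [[Dx ->]|[nDx ->]] [[Dx' []]|[nDx' []]] //.
  - by move=> _ /hinj.
  - by move=> _ /hinj.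
  - by move=> /einj->.
have {AD2} AD : A #<= dom H := card_le_trans AD2 HH.
apply: card_le_trans (card_leX AD AD) _; apply: card_le_trans HH _.
by apply: subset_card_le => x [w /Hdom[[]]].
Qed.

End CardSquare.

(** * Transfinite construction *)

(** If some initial segment of a well-order is as large as [K], take the least [x0] bounding such a
    segment and pull the order back along an injection of [K] below [x0]. *)
Lemma initial_well_order (K : Type) : exists lt : K -> K -> Prop,
  [/\ well_founded lt, forall x y, [\/ x = y, lt x y | lt y x] &
      forall x, ~ ([set: K] #<= [set y | lt y x])].
Proof.
have [lt [ltwf lttri]] : exists lt : K -> K -> Prop,
    well_founded lt /\ forall x y, [\/ x = y, lt x y | lt y x].
  elim/Peq: K => K; have [R Rwo] := well_ordering_principle K.
  (* Totality and antisymmetry come from the existence and uniqueness of the minimum of a pair. *)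
  have Rtot : total R.
    move=> x y; have [|z [[]]] := Rwo [pred z | (z == x) || (z == y)].
      by exists x; rewrite inE eqxx.
    move=> /orP[]/eqP-> zP _; first by rewrite zP // inE eqxx orbT.
    by rewrite orbC zP // inE eqxx.
  have Ranti x y : R x y -> R y x -> x = y.
    move=> Rxy Ryx; have Rxx z : R z z by have := Rtot z z; rewrite orbb.
    have [|z [_ zU]] := Rwo [pred z | (z == x) || (z == y)].
      by exists x; rewrite inE eqxx.
    transitivity z; [symmetry|]; apply: zU; split;
        rewrite ?inE ?eqxx ?orbT // => w.
      by rewrite inE => /orP[]/eqP->.
    by rewrite inE => /orP[]/eqP->.
  exists (fun x y => R x y /\ x <> y); split=> [x|x y]; last first.
    have [->|/eqP xy] := eqVneq x y; first by constructor 1.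
    have /orP[Rxy|Ryx] := Rtot x y; first by constructor 2.
    by constructor 3; split=> // /esym.
  apply: contrapT => nAcc.
  have [|z [[/asboolP nz zmin] _]] :=
      Rwo [pred z | `[< ~ Acc (fun x y => R x y /\ x <> y) z >]].
    by exists x; exact/asboolP.
  apply: nz; constructor => y [Ryz yz]; apply: contrapT => nAccy.
  by apply: yz; apply: Ranti => //; apply: zmin; exact/asboolP.
have [ltsmall|] := pselect (forall x, ~ ([set: K] #<= [set y | lt y x])).
  by exists lt.
move=> /existsNP[x0 /contrapT]; elim/(well_founded_ind ltwf): x0 => x0 IH Kx0.
have [[x ltx Kx]|nx] :=
    pselect (exists2 x, lt x x0 & [set: K] #<= [set y | lt y x]).
  exact: IH Kx.
have [f fx0 finj] := card_le_fun x0 Kx0.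
(* The map [f] injects the new segment below [x] into the old segment below [f x]; as [f x] precedes
   [x0], minimality of [x0] makes the latter smaller than [K]. *)
exists (fun x y => lt (f x) (f y)); split=> [x|x y|x Kx].
- have [z fxz] : exists z, f x = z by exists (f x).
  elim/(well_founded_ind ltwf): z x fxz => z IHz x fxz.
  apply: Acc_intro => y yx; apply: (IHz (f y)); last by [].
  by rewrite -fxz.
- have [/finj xy|xy|yx] := lttri (f x) (f y).
  + by constructor 1; exact: xy.
  + by constructor 2.
  + by constructor 3.
- apply: nx; exists (f x); first exact: fx0.
  apply: (card_le_trans Kx).
  apply: (card_le_rel (R := fun y z => z = f y)) => [y|y y' z _ _ -> /finj].
    by exists (f y).
  exact.
Qed.

(** The other two cases of trichotomy would create cycles of length two or three, which
    well-foundedness forbids. *)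
Lemma well_founded_trichotomy_trans (K : Type) (lt : K -> K -> Prop) :
  well_founded lt -> (forall x y, [\/ x = y, lt x y | lt y x]) ->
  forall x y z, lt x y -> lt y z -> lt x z.
Proof.
move=> ltwf lttri.
have cycle3 : forall x y z, lt x y -> lt y z -> lt z x -> False.
  by elim/(well_founded_ind ltwf) => x IH y z xy yz zx; exact: (IH _ zx x y).
have cycle2 : forall x y, lt x y -> lt y x -> False.
  by elim/(well_founded_ind ltwf) => x IH y xy yx; exact: (IH _ yx x).
move=> x y z xy yz; have [E|//|zx] := lttri x z; last by case: (cycle3 x y z).
by case: (cycle2 x y xy); rewrite E.
Qed.

Lemma well_founded_union_rec (K U : Type) (lt : K -> K -> Prop)
    (step : set U -> K -> set U) : well_founded lt ->
  exists g : K -> set U,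
    forall i, g i = step (\bigcup_(j in [set j | lt j i]) g j) i.
Proof.
move=> ltwf; pose body i (rec : forall j, lt j i -> set U) : set U :=
  step [set u | exists j (ji : lt j i), rec j ji u] i.
exists (Fix ltwf (fun=> set U) body) => i; rewrite Fix_eq.
  congr step; apply/seteqP; split=> u; first by move=> [j [ji gu]]; exists j.
  by move=> [j ji gu]; exists j, ji.
move=> {}i f g fg; congr (body i); apply/functional_extensionality_dep => j.
by apply/functional_extensionality_dep => ji; exact: fg.
Qed.

(** Keeps every stage small. For infinite [D], numbering each [g i] embeds the union into pairs from
    [D] and [nat], and [card_square_le] bounds these by [D]. *)
Lemma bigcup_finite_small (K I U : Type) (D : set I) (g : I -> set U) :
  infinite_set [set: K] -> ~ ([set: K] #<= D) ->
  (forall i, D i -> finite_set (g i)) ->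
  ~ ([set: K] #<= \bigcup_(i in D) g i).
Proof.
move=> Kinf KD gfin Kg; have [Dfin|Dinf] := pselect (finite_set D).
  by apply: Kinf; apply: card_le_finite Kg _; exact: bigcup_finite.
apply: KD; apply: (card_le_trans Kg).
apply: (@card_le_trans _ _ _ (D `*` [set: nat])).
  have /choice[c cinj] : forall i, exists c : U -> nat, D i ->
      forall u u', g i u -> g i u' -> c u = c u' -> u = u'.
    move=> i; have [Di|nDi] := pselect (D i); last by exists (fun=> 0%N).
    have /finite_set_countable/(card_le_fun 0%N)[c _ cinj] := gfin _ Di.
    by exists c.
  apply: (card_le_rel (R := fun u p => [/\ D p.1, g p.1 u & p.2 = c p.1 u])).
    by move=> u [i Di giu]; exists (i, c i u).
  by move=> u u' [i n] _ _ /= [Di giu ->] [_ giu']; exact: cinj.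
apply: card_le_trans (card_square_le Dinf).
by apply: card_leX (card_lexx _) _; exact/infiniteP.
Qed.

(** Stage [i] adds a finite set meeting requirement [i]. Each stage starts small, as fewer than
    [|K|] finite sets precede it; [P] survives unions by the chain hypothesis, and monotonicity of
    [Q] preserves what is achieved. *)
Lemma transfinite_extension (K U : Type) (P : set U -> Prop)
    (Q : K -> set U -> Prop) :
  infinite_set [set: K] ->
  (forall F : set (set U), F `<=` P -> total_on F subset ->
    P (\bigcup_(X in F) X)) ->
  (forall i X Y, X `<=` Y -> Q i X -> Q i Y) ->
  (forall S i, P S -> ~ ([set: K] #<= S) ->
    exists D, [/\ finite_set D, P (S `|` D) & Q i (S `|` D)]) ->
  exists2 S, P S & forall i, Q i S.
Proof.
move=> Kinf Pchain Qmono ext.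
have [lt [ltwf lttri ltsmall]] := initial_well_order K.
have lttrans := well_founded_trichotomy_trans ltwf lttri.
have /choice[step stepP] : forall p : set U * K, exists D, P p.1 ->
    ~ ([set: K] #<= p.1) ->
    [/\ finite_set D, P (p.1 `|` D) & Q p.2 (p.1 `|` D)].
  move=> [S i]; have [[PS KS]|nPS] := pselect (P S /\ ~ ([set: K] #<= S)).
    by have [D ?] := ext _ i PS KS; exists D.
  by exists set0 => PS KS; case: nPS.
have [g gE] := well_founded_union_rec (fun S i => step (S, i)) ltwf.
pose S i := \bigcup_(j in [set j | lt j i]) g j.
have stage_le i j : lt i j -> S i `|` g i `<=` S j.
  by move=> ij u [[k ki gu]|gu]; [exists k => //; exact: lttrans ij|exists i].
have stage_total (D : set K) : total_on [set S i `|` g i | i in D] subset.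
  move=> _ _ [i Di <-] [j Dj <-].
  have [->|/stage_le ij|/stage_le ji] := lttri i j; first by left.
  - by left; apply: (subset_trans ij) => u; left.
  - by right; apply: (subset_trans ji) => u; left.
(* Being the union of a chain of completed stages, [S i] inherits [P]. This treats successor and
   limit stages alike, and the least stage as the empty chain. *)
have SE i : S i = \bigcup_(X in [set S j `|` g j | j in [set j | lt j i]]) X.
  rewrite bigcup_image; apply/seteqP; split=> u [j ji gu].
    by exists j => //; right.
  exact: stage_le gu.
have main i : [/\ finite_set (g i), P (S i `|` g i) & Q i (S i `|` g i)].
  elim/(well_founded_ind ltwf): i => i IH; rewrite gE.
  apply: (stepP (S i, i)) => /=.
    by rewrite SE; apply: Pchain => // _ [j ji <-]; have [] := IH _ ji.
  by apply: bigcup_finite_small => // j ji; have [] := IH _ ji.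
exists (\bigcup_(X in [set S i `|` g i | i in [set: K]]) X).
  by apply: Pchain => // _ [i _ <-]; have [] := main i.
move=> i; have [_ _] := main i; apply: Qmono => u Su.
by exists (S i `|` g i) => //; exists i.
Qed.

(** * Simultaneous placement of the factors *)

Section Placement.
Variables (K A : Type) (F : A -> graph K).
Implicit Types (S X Y : set (A * K * K)) (a b : A) (u v x y : K).

(** For the final [S], this becomes the adjacency relation of [Gamma a]. *)
Definition covers S a x y : Prop :=
  exists u v, [/\ S (a, u, x), S (a, v, y) & adj (F a) u v].

(** One set of triples encodes all partial embeddings at once, so that extension is inclusion and
    limits are unions. The last clause keeps the copies edge-disjoint. *)
Definition placement S : Prop :=
  [/\ forall a v x y, S (a, v, x) -> S (a, v, y) -> x = y,
      forall a u v x, S (a, u, x) -> S (a, v, x) -> u = v &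
      forall a b x y, covers S a x y -> covers S b x y -> a = b].

Lemma covers_sym S a x y : covers S a x y -> covers S a y x.
Proof.
by move=> [u [v [Su Sv uv]]]; exists v, u; split=> //; exact: adj_sym.
Qed.

Lemma covers_sub X Y a x y : X `<=` Y -> covers X a x y -> covers Y a x y.
Proof. by move=> XY [u [v [/XY Xu /XY Xv uv]]]; exists u, v. Qed.

(** Each clause involves at most four triples, which [chain_cofinal] gathers in one member of the
    chain. *)
Lemma placement_bigcup (C : set (set (A * K * K))) :
  C `<=` placement -> total_on C subset -> placement (\bigcup_(X in C) X).
Proof.
move=> CP Ctot; split=> [a v x y [X CX Xx]|a u v x [X CX Xx]|a b x y].
- move=> /(chain_cofinal Ctot CX)[Y [/CP[Yf _ _] XY]].
  exact: (Yf a v x y (XY _ Xx)).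
- move=> /(chain_cofinal Ctot CX)[Y [/CP[_ Yi _] XY]].
  exact: (Yi a u v x (XY _ Xx)).
- move=> [u [v [[X CX Xu] /(chain_cofinal Ctot CX)[Y [CY XY Yv]] uv]]].
  move=> [u' [v' [/(chain_cofinal Ctot CY)[Z [CZ YZ Zu']]]]].
  move=> /(chain_cofinal Ctot CZ)[W [/CP[_ _ Wd] ZW Wv']] uv'.
  apply: (Wd a b x y).
    by exists u, v; split=> //; apply/ZW/YZ => //; exact: XY.
  by exists u', v'; split=> //; exact: ZW.
Qed.

(** The pairs that become covered join [x] to the places of the placed neighbours of [v], and only
    copy [a] gains them; by the last hypothesis no copy covers them yet. *)
Lemma placement_add S a v x : placement S ->
  (forall y, ~ S (a, v, y)) -> (forall u, ~ S (a, u, x)) ->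
  (forall u y b, S (a, u, y) -> adj (F a) v u -> ~ covers S b x y) ->
  placement (S `|` [set (a, v, x)]).
Proof.
move=> [Sf Si Sd] nSv nSx nScov.
pose new y z := y = x /\ exists2 u, S (a, u, z) & adj (F a) v u.
have coversE b y z : covers (S `|` [set (a, v, x)]) b y z ->
    covers S b y z \/ (b = a /\ (new y z \/ new z y)).
  move=> [u [w []]] [Su|[-> -> ->]] [Sw|].
  - by move=> uw; left; exists u, w.
  - move=> [eb -> ->] uw; right; split=> //; right; split=> //.
    by rewrite eb in Su uw; exists u => //; exact: adj_sym.
  - by move=> vw; right; split=> //; left; split=> //; exists w.
  - by move=> [-> _] vv; case: (adj_irrefl vv).
have new_covers b y z : new y z -> ~ covers S b y z.
  by move=> [-> [u Suz vu]]; exact: nScov Suz vu.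
have new_covers' b y z : new z y -> ~ covers S b y z.
  by move=> /new_covers zy /covers_sym; exact: zy.
split=> [b u y z|b u w y|b c y z].
- move=> [Sy|[eb eu ey]] [Sz|[eb' eu' ez]]; first exact: Sf Sy Sz.
  + by case: (nSv y); rewrite -eb' -eu'.
  + by case: (nSv z); rewrite -eb -eu.
  + by rewrite ey ez.
- move=> [Su|[eb eu ey]] [Sw|[eb' ew ey']]; first exact: Si Su Sw.
  + by case: (nSx u); rewrite -eb' -ey'.
  + by case: (nSx w); rewrite -eb -ey.
  + by rewrite eu ew.
- move=> /coversE[cb|[-> [nb|nb]]] /coversE[cc|[-> [nc|nc]]] //.
  + exact: Sd cb cc.
  + by have := new_covers _ _ _ nc cb.
  + by have := new_covers' _ _ _ nc cb.
  + by have := new_covers _ _ _ nb cc.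
  + by have := new_covers' _ _ _ nb cc.
Qed.

Hypothesis A_card : [set: K] #<= [set: A].
Hypothesis F_edge : forall a, exists u v, adj (F a) u v.
Hypothesis F_dom : forall a (D : set K), dominating (F a) D -> [set: K] #<= D.

Lemma placement_vertex S a v : placement S -> ~ ([set: K] #<= S) ->
  exists D, [/\ finite_set D, placement (S `|` D) &
    exists x, (S `|` D) (a, v, x)].
Proof.
move=> SP Ssmall; have [[x Svx]|nSv] := pselect (exists x, S (a, v, x)).
  by exists set0; rewrite setU0; split=> //; exists x.
(* If every point occurred in [S], picking a triple at each would inject [K] into [S]. *)
have [x nSx] : exists x, forall b u, ~ S (b, u, x).
  apply: contrapT => nx; apply: Ssmall.
  apply: (card_le_rel (R := fun x p => p.2 = x)) => [x _|x x' p _ _ -> //].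
  apply: contrapT => nSx; apply: nx; exists x => b u Sx.
  by apply: nSx; exists (b, u, x).
exists [set (a, v, x)]; split; [exact: finite_set1| |by exists x; right].
apply: placement_add => // [y Sv|u y b _ _ [u' [v' [Sx _ _]]]].
  by apply: nSv; exists y.
exact: nSx Sx.
Qed.

Lemma placement_point S a x : placement S -> ~ ([set: K] #<= S) ->
  exists D, [/\ finite_set D, placement (S `|` D) &
    exists v, (S `|` D) (a, v, x)].
Proof.
move=> SP Ssmall; have [[v Svx]|nSx] := pselect (exists v, S (a, v, x)).
  by exists set0; rewrite setU0; split=> //; exists v.
(* The placed vertices of copy [a] inject into [S] by picking a triple for each, so they cannot
   dominate; [v] witnesses this. *)
have /existsNP[v /not_implyP[nv nadj]] :
    ~ dominating (F a) [set u | exists y, S (a, u, y)].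
  move=> /F_dom KD; apply: Ssmall; apply: (card_le_trans KD).
  apply: (card_le_rel (R := fun u p => p.1.2 = u)); last by move=> ? ? ? _ _ ->.
  by move=> u [y Suy]; exists (a, u, y).
exists [set (a, v, x)]; split; [exact: finite_set1| |by exists v; right].
apply: placement_add => // [y Sv|u Sx|u y b Su vu _].
- by apply: nv; exists y.
- by apply: nSx; exists u.
- by apply: nadj; exists u => //; exists y.
Qed.

Lemma placement_edge S x y : placement S -> ~ ([set: K] #<= S) -> x <> y ->
  exists D, [/\ finite_set D, placement (S `|` D) &
    exists a, covers (S `|` D) a x y].
Proof.
move=> SP Ssmall xy; have [[a Sa]|nSxy] := pselect (exists a, covers S a x y).
  by exists set0; rewrite setU0; split=> //; exists a.
(* Since [K] injects into [A], so small an [S] leaves some copy untouched. *)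
have [a nSa] : exists a, forall u z, ~ S (a, u, z).
  apply: contrapT => na; apply: Ssmall; apply: (card_le_trans A_card).
  apply: (card_le_rel (R := fun a p => p.1.1 = a)) => [a _|a a' p _ _ -> //].
  apply: contrapT => nSa; apply: na; exists a => u z Su.
  by apply: nSa; exists (a, u, z).
have [u [v uv]] := F_edge a.
exists ([set (a, u, x)] `|` [set (a, v, y)]); rewrite setUA.
have SP1 : placement (S `|` [set (a, u, x)]).
  by apply: placement_add => // w z b /nSa.
split; first by rewrite finite_setU; split; exact: finite_set1.
(* The first triple is alone in copy [a] and covers nothing; the second newly covers only the pair
   [x], [y], which is free by [nSxy]. *)
- apply: placement_add => // [z|w|w z b].
  + move=> [/nSa//|[vu _]]; rewrite vu in uv; exact: (adj_irrefl uv).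
  + by move=> [/nSa//|[_ yx]]; apply: xy.
  + move=> [/nSa//|[-> ->]] _ [p [q [Sp Sq pq]]]; apply: nSxy.
    case: Sp => [Sp|[_ _ /esym//]].
    case: Sq => [Sq|[eb _]]; last by case: (nSa p y); rewrite -eb.
    by exists b; apply: covers_sym; exists p, q.
- by exists a, u, v; split=> //; [left; right|right].
Qed.

Lemma placement_complete : infinite_set [set: K] -> [set: A] #<= [set: K] ->
  exists S, [/\ placement S, forall a v, exists x, S (a, v, x),
    forall a x, exists v, S (a, v, x) &
    forall x y, x <> y -> exists a, covers S a x y].
Proof.
move=> Kinf AK; have [k0 _] := infinite_setN0 Kinf.
pose task : Type := (A * K) + (A * K) + (K * K).
pose done (t : task) S := match t with
  | inl (inl (a, v)) => exists x, S (a, v, x)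
  | inl (inr (a, x)) => exists v, S (a, v, x)
  | inr (x, y) => x <> y -> exists a, covers S a x y
  end.
have ext (t : task) S : placement S -> ~ ([set: K] #<= S) ->
    exists D, [/\ finite_set D, placement (S `|` D) & done t (S `|` D)].
  move=> SP KS; case: t => [[[a v]|[a x]]|[x y]] /=.
  - exact: placement_vertex.
  - exact: placement_point.
  - have [xy|xy] := pselect (x = y); first by exists set0; rewrite setU0.
    by have [D [Dfin DP Dxy]] := placement_edge SP KS xy; exists D.
have [i _ iinj] := card_le_fun k0 AK.
have Kprod := card_square_le Kinf; rewrite setXTT in Kprod.
have [pr _ prinj] := card_le_fun k0 Kprod.
have /infiniteP/(card_le_fun k0)[h _ hinj] := Kinf.
(* The values of [h] at 0, 1 and 2 are tags separating the three kinds of task. *)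
pose code (t : task) : K := match t with
  | inl (inl (a, v)) => pr (h 0%N, pr (i a, v))
  | inl (inr (a, x)) => pr (h 1%N, pr (i a, x))
  | inr (x, y) => pr (h 2%N, pr (x, y))
  end.
have codeinj : injective code.
  have {}prinj : injective pr by move=> p q; exact: prinj.
  have {}hinj : injective h by move=> m n; exact: hinj.
  have {}iinj : injective i by move=> a b; exact: iinj.
  case=> [[[a v]|[a v]]|[a v]] [[[b w]|[b w]]|[b w]] /prinj[];
    try by move=> /hinj.
  - by move=> /prinj[/iinj-> ->].
  - by move=> /prinj[/iinj-> ->].
  - by move=> /prinj[-> ->].
(* Stage [k] performs the task with code [k], unique by injectivity of [code]; if there is none, it
   adds nothing. *)
have [||||S SP Sdone] := @transfinite_extension K _ placement
    (fun k S => forall t, code t = k -> done t S).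
- exact: Kinf.
- exact: placement_bigcup.
- move=> k X Y XY Xk t /Xk; case: t => [[[a v]|[a x]]|[x y]] /=.
  + by move=> [x /XY]; exists x.
  + by move=> [v /XY]; exists v.
  + by move=> + /[dup] xy => /[apply] -[a /(covers_sub XY)]; exists a.
- move=> S k SP KS.
  have [[t tk]|nt] := pselect (exists t, code t = k).
    have [D [Dfin DP Dt]] := ext t S SP KS; exists D; split=> // t'.
    by rewrite -tk => /codeinj->.
  by exists set0; rewrite setU0; split=> // t tk; case: nt; exists t.
exists S; split=> // [a v|a x|x y].
- exact: (Sdone _ (inl (inl (a, v))) erefl).
- exact: (Sdone _ (inl (inr (a, x))) erefl).
- exact: (Sdone _ (inr (x, y)) erefl).
Qed.

(** The final placement is total in both directions, so each copy is a bijection; edge-disjointness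
    and the covering of every pair give the partition. *)
Theorem factorization_complete :
  infinite_set [set: K] -> [set: A] #<= [set: K] ->
  exists Gamma : A -> graph K,
    factorization (complete K) Gamma /\
    forall a : A, isomorphic (Gamma a) (F a).
Proof.
move=> Kinf AK; have [S [[Sf Si Sd] Sv Sx Se]] := placement_complete Kinf AK.
have cov_irrefl a x : ~ covers S a x x.
  move=> [u [v [Su Sv' uv]]]; have E := Si _ _ _ _ Su Sv'.
  by rewrite E in uv; exact: (adj_irrefl uv).
pose Gamma a := Graph (@covers_sym S a) (cov_irrefl a).
have Gsub a : factor (Gamma a) (complete K).
  move=> _ [x [y [cxy ->]]]; exists x, y; split=> // xy.
  by rewrite xy in cxy; exact: (cov_irrefl _ _ cxy).
exists Gamma; split; last first.
  (* Here [f] sends a point to the vertex placed there, and [g] sends a vertex to its place. *)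
  move=> a; have [f fP] := choice (Sx a); have [g gP] := choice (Sv a).
  exists f.
    by exists g => [x|v]; [exact: Sf (gP _) (fP _)|exact: Si (fP _) (gP _)].
  move=> x y; split=> [[u [v [Su Sv' uv]]]|fxy]; last by exists (f x), (f y).
  by rewrite (Si _ _ _ _ (fP x) Su) (Si _ _ _ _ (fP y) Sv').
split=> //; split.
- apply/seteqP; split=> [e [a _ /Gsub]//|_ [x [y [/Se[a cxy] ->]]]].
  by exists a => //; exists x, y.
(* Matching the endpoints of one unordered pair gives the same order, the swapped order, or a loop,
   which [cov_irrefl] excludes. *)
- move=> a b _ _ [e [[x [y [cxy ->]]] [x' [y' [cxy' E]]]]].
  apply: (Sd _ _ x y cxy).
  have : [set x'; y'] y by rewrite -E; right.
  have : [set x'; y'] x by rewrite -E; left.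
  move=> [] /= xE [] /= yE; rewrite xE yE // in cxy *.
  + by have := cov_irrefl _ _ cxy.
  + exact: covers_sym.
  + by have := cov_irrefl _ _ cxy.
(* The blocks of a [partition] must be nonempty; an edge of [F a] provides this. *)
- move=> a _; have [u [v uv]] := F_edge a.
  have [x Sux] := Sv a u; have [y Svy] := Sv a v.
  by exists [set x; y], x, y; split=> //; exists u, v.
Qed.

End Placement.

(** * Transport to factors on arbitrary vertex types *)

Theorem theorem1p4 (K A : Type) (V : A -> Type) (F : forall a : A, graph (V a))
  (K_infinite : infinite_set [set: K])
  (F_order : forall a : A, [set: V a] #= [set: K])
  (F_edge : forall a : A, edges (F a) !=set0)
  (A_card : [set: A] #= [set: K])
  (F_domination : forall a : A, domination_number_eq (F a) [set: K]) :
  exists Gamma : A -> graph K,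
    factorization (complete K) Gamma /\
    forall a : A, isomorphic (Gamma a) (F a).
Proof.
have [k0 _] := infinite_setN0 K_infinite.
have bijV a : exists p : (V a -> K) * (K -> V a),
    cancel p.1 p.2 /\ cancel p.2 p.1.
  have [f [g fg gf]] := card_eq_bijective k0 (F_order a).
  by exists (f, g).
pose f a := (sval (cid (bijV a))).1; pose g a := (sval (cid (bijV a))).2.
have gP a : cancel (f a) (g a) /\ cancel (g a) (f a) := svalP (cid (bijV a)).
(* The placement works with factors on the single vertex type [K], so each [F a] is copied there
   through its bijection. *)
pose F' a := Graph (adj := fun x y => adj (F a) (g a x) (g a y))
  (fun x y => @adj_sym _ (F a) _ _) (fun x => @adj_irrefl _ (F a) _).
have /andP[AK KA] : ([set: A] #<= [set: K]) && ([set: K] #<= [set: A]).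
  by rewrite -card_eq_le.
have [//|a|a D Ddom|//|//|Gamma [Gfact Giso]] := @factorization_complete K A F'.
- have [_ [u [v [uv _]]]] := F_edge a; exists (f a u), (f a v) => /=.
  by have [-> ->] := ((gP a).1 u, (gP a).1 v).
(* A dominating set of [F' a] pulls back along [f a] to one of [F a], which is as large as [K] and
   injects back into [D]. *)
- have [_ /(_ [set v | D (f a v)]) KD] := F_domination a.
  have {}KD : [set: K] #<= [set v | D (f a v)].
    apply: KD => v /Ddom[y Dy /=]; rewrite (gP a).1 => vy.
    by exists (g a y) => //=; rewrite (gP a).2.
  apply: (card_le_trans KD).
  apply: (card_le_rel (R := fun v x => x = f a v)) => [v Dv|v v' x _ _ ->].
    by exists (f a v).
  exact: (can_inj (gP a).1).
exists Gamma; split=> // a; have [h hbij hadj] := Giso a.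
exists (g a \o h) => //; apply: bij_comp => //.
by exists (f a); have [] := gP a.
Qed.
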